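(* If $u$ is an odd permutation in $G=S_n$ and $m$ is an odd positive integer, then $\tilde G_m(u)=\{h\in S_n : (uh)^m=h^m\}$ is empty. Thus $\nu_m(\chi)=0$ whenever $m$ is an odd positive integer and $\chi$ is an irreducible character of $D(S_n)$ induced from an irreducible character of $C_{S_n}(u)$ for $u$ an odd permutation.
   Context: For a finite group $G$, the Drinfel'd double $D(G)$ is the semisimple Hopf algebra over $\mathbb{C}$ with basis $\{p_g\bowtie x : g,x\in G\}$, multiplication $(p_k\bowtie z)(p_h\bowtie y)=\delta_{k,zhz^{-1}}\,p_k\bowtie zy$, unit $\sum_{g\in G}p_g\bowtie 1$, comultiplication $\Delta(p_g\bowtie x)=\sum_{h\in G}(p_h\bowtie x)\otimes(p_{h^{-1}g}\bowtie x)$, counit $\epsilon(p_g\bowtie x)=\delta_{g,1}$ and antipode $S(p_g\bowtie x)=p_{x^{-1}g^{-1}x}\bowtie x^{-1}$. Put $\Lambda=\frac1{|G|}\sum_{g\in G}p_1\bowtie g$, and for $m\ge1$ let $\Lambda^{[m]}=\sum\Lambda_1\cdots\Lambda_m$ be the $m$-fold product of the iterated comultiplication of $\Lambda$ ($\Lambda^{[1]}=\Lambda$). For an irreducible character $\chi$ of $D(G)$ (trace function of a simple module), $\nu_m(\chi)=\chi(\Lambda^{[m]})$ is its $m$-th Frobenius-Schur indicator. For $u\in G$ and a simple $\mathbb{C}C_G(u)$-module $V$ with character $\eta$, the space $\hat V=\mathbb{C}G\otimes_{\mathbb{C}C_G(u)}V$ is a simple $D(G)$-module via $(p_h\bowtie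 x)\cdot(y\otimes v)=\delta_{xyu(xy)^{-1},\,h}\;xy\otimes v$ for $h,x,y\in G$, $v\in V$; its character is called the character of $D(G)$ induced from $\eta$. *)

(* Defs.v *)
From HB Require Import structures.
From mathcomp Require Import all_boot all_order all_fingroup all_algebra.
From mathcomp Require Import mxrepresentation.

Set Implicit Arguments.
Unset Strict Implicit.
Unset Printing Implicit Defensive.

Import GRing.Theory.
Local Open Scope ring_scope.

(* An element of D(G), with G the whole finGroupType gT, is given by its
   coordinates on the basis p_g >< x, indexed by the pairs (g, x). *)
Definition drinfeld_double (F : fieldType) (gT : finGroupType) : Type :=
  {ffun gT * gT -> F^o}.

HB.instance Definition _ (F : fieldType) (gT : finGroupType) :=
  Vector.copy (drinfeld_double F gT) {ffun gT * gT -> F^o}.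

Section Double.
Variables (F : fieldType) (gT : finGroupType).
Local Notation D := (drinfeld_double F gT).
Implicit Types (a b c : D) (g h k x y z : gT) (s t : gT * gT).

Definition pbow g x : D := [ffun s => (s == (g, x))%:R].

Definition bmul s t : D :=
  if s.1 == (s.2 * t.1 * s.2^-1)%g then pbow s.1 (s.2 * t.2)%g else 0.

Definition dmul a b : D := \sum_s \sum_t ((a s : F) * (b t : F)) *: bmul s t.

Definition done1 : D := \sum_g pbow g 1%g.

Lemma pbow_sum a : a = \sum_s (a s : F) *: pbow s.1 s.2.
Proof.
apply/ffunP => t; rewrite sum_ffunE (bigD1 t) //= !ffunE -surjective_pairing.
rewrite eqxx big1 ?addr0 => [|s nst]; first by rewrite [RHS]mulr1.
rewrite !ffunE -surjective_pairing eq_sym (negPf nst); exact: mulr0.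
Qed.

Lemma dmul_linearl b : linear (dmul^~ b).
Proof.
move=> k a a'; rewrite /dmul scaler_sumr -big_split; apply: eq_bigr => s _ /=.
rewrite scaler_sumr -big_split; apply: eq_bigr => t _ /=.
by rewrite !ffunE scalerA -scalerDl; congr (_ *: _); rewrite mulrA -mulrDl.
Qed.

Lemma dmul_linearr a : linear (dmul a).
Proof.
move=> k b b'; rewrite /dmul scaler_sumr -big_split; apply: eq_bigr => s _ /=.
rewrite scaler_sumr -big_split; apply: eq_bigr => t _ /=.
rewrite !ffunE scalerA -scalerDl; congr (_ *: _).
by rewrite mulrDr; congr (_ + _); apply: mulrCA.
Qed.

Definition dmulr b a := dmul a b.

HB.instance Definition _ b :=
  GRing.isLinear.Build F D D *:%R (dmulr b) (dmul_linearl b).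
HB.instance Definition _ a :=
  GRing.isLinear.Build F D D *:%R (dmul a) (dmul_linearr a).

Lemma dmul_pbow k z h y :
  dmul (pbow k z) (pbow h y) =
  if k == (z * h * z^-1)%g then pbow k (z * y)%g else 0.
Proof.
rewrite /dmul (bigD1 (k, z)) //= (bigD1 (h, y)) //= !ffunE !eqxx mulr1 scale1r.
rewrite !big1 ?addr0 // => s ns.
  by rewrite big1 // => t _; rewrite !ffunE (negPf ns) mul0r scale0r.
by rewrite !ffunE (negPf ns) mulr0 scale0r.
Qed.

Lemma dmul_suml I (r : seq I) (P : pred I) (E : I -> D) b :
  dmul (\sum_(i <- r | P i) E i) b = \sum_(i <- r | P i) dmul (E i) b.
Proof. exact: (linear_sum (dmulr b)). Qed.

Lemma dmul0l b : dmul 0 b = 0.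
Proof. exact: (linear0 (dmulr b)). Qed.

Lemma dmulZl (r : F) a b : dmul (r *: a) b = r *: dmul a b.
Proof. exact: (linearZ_LR (dmulr b)). Qed.

Lemma dmulZr (r : F) a b : dmul a (r *: b) = r *: dmul a b.
Proof. exact: linearZ_LR. Qed.

Lemma dmulA : associative dmul.
Proof.
move=> a b c; rewrite (pbow_sum a) dmul_suml
  [in RHS](dmul_suml _ _ _ b) dmul_suml.
apply: eq_bigr => [[k z] _] /=; rewrite !dmulZl; congr (_ *: _).
rewrite (pbow_sum b) [in LHS](dmul_suml _ _ _ c) 
  !linear_sum dmul_suml.
apply: eq_bigr => [[h y] _] /=; rewrite !(dmulZl, dmulZr); congr (_ *: _).
rewrite (pbow_sum c) (linear_sum (dmul (pbow h y))) !linear_sum.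
apply: eq_bigr => [[l x] _] /=.
rewrite !dmulZr; congr (_ *: _); rewrite !dmul_pbow.
have [->|nh] := eqVneq h (y * l * y^-1)%g.
  rewrite dmul_pbow; case: eqP => [->|_]; last by rewrite dmul0l.
  by rewrite dmul_pbow invMg !mulgA eqxx.
rewrite linear0; case: eqP => [->|_]; last by rewrite dmul0l.
rewrite dmul_pbow invMg !mulgA; case: eqP => // /mulIg.
by rewrite -!mulgA => /mulgI e; rewrite e !mulgA eqxx in nh.
Qed.

Lemma dmul1l : left_id done1 dmul.
Proof.
move=> a; rewrite {1}(pbow_sum a) linear_sum [RHS]pbow_sum.
apply: eq_bigr => [[g x] _] /=; rewrite dmulZr; congr (_ *: _).
rewrite dmul_suml (bigD1 g) //= dmul_pbow mul1g invg1 mulg1 eqxx mul1g.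
rewrite big1 ?addr0 // => h nh.
by rewrite dmul_pbow mul1g invg1 mulg1 (negPf nh).
Qed.

Lemma dmul1r : right_id done1 dmul.
Proof.
move=> a; rewrite {1}(pbow_sum a) dmul_suml [RHS]pbow_sum.
apply: eq_bigr => [[g x] _] /=; rewrite dmulZl.
congr (_ *: _); rewrite linear_sum (bigD1 (x^-1 * g * x)%g) //= dmul_pbow.
rewrite !mulgA mulgV mul1g mulgK eqxx mulg1 big1 ?addr0 // => h nh.
rewrite dmul_pbow; case: eqP => // e; rewrite e !mulgA in nh.
by rewrite mulVg mul1g mulgKV eqxx in nh.
Qed.

Lemma dmulDl : left_distributive dmul +%R.
Proof. move=> a b c; exact: (linearD (dmulr c)). Qed.

Lemma dmulDr : right_distributive dmul +%R.
Proof. by move=> a b c; rewrite linearD. Qed.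

Lemma done1_neq0 : done1 != 0.
Proof.
apply/eqP => /ffunP /(_ (1%g, 1%g)) /eqP.
rewrite sum_ffunE (bigD1 1%g) //= !ffunE eqxx big1 ?addr0 ?oner_eq0 // => g ng.
by rewrite !ffunE xpair_eqE eq_sym (negPf ng).
Qed.

HB.instance Definition _ := GRing.Zmodule_isNzRing.Build D
  dmulA dmul1l dmul1r dmulDl dmulDr done1_neq0.

Lemma pbowM k z h y :
  pbow k z * pbow h y =
  if k == (z * h * z^-1)%g then pbow k (z * y)%g else 0.
Proof. exact: dmul_pbow. Qed.

Lemma dscaleAl (k : F) a b : k *: (a * b) = (k *: a) * b.
Proof. exact/esym/dmulZl. Qed.

Lemma dscaleAr (k : F) a b : k *: (a * b) = a * (k *: b).
Proof. exact/esym/dmulZr. Qed.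

HB.instance Definition _ := GRing.Lmodule_isLalgebra.Build F D dscaleAl.
HB.instance Definition _ := GRing.Lalgebra_isAlgebra.Build F D dscaleAr.

(* The m-th tensor power of D(G), in coordinates on the basis
   (p_{g_1} >< x_1) (x) ... (x) (p_{g_m} >< x_m). *)
Definition tpow (m : nat) : Type := {ffun m.-tuple (gT * gT) -> F^o}.

HB.instance Definition _ m :=
  Vector.copy (tpow m) {ffun m.-tuple (gT * gT) -> F^o}.

Definition tbasis m (s : m.-tuple (gT * gT)) : tpow m :=
  [ffun t => (t == s)%:R].

(* Delta (x) id (x) ... (x) id *)
Definition comul_head m (w : tpow m.+1) : tpow m.+2 :=
  \sum_(s : m.+1.-tuple (gT * gT)) (w s : F) *:
    \sum_(h : gT)
      tbasis [tuple of (h, (thead s).2)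
                    :: ((h^-1 * (thead s).1)%g, (thead s).2) :: behead s].

(* Delta iterated m times: there are m.+1 tensor factors. *)
Fixpoint comul_iter m : D -> tpow m.+1 :=
  if m is m'.+1 then fun a => comul_head (comul_iter m' a)
  else fun a => [ffun s => a (thead s)].

Definition tmul m (w : tpow m) : D :=
  \sum_(s : m.-tuple (gT * gT)) (w s : F) *:
    \prod_(i < m) pbow (tnth s i).1 (tnth s i).2.

Lemma comul_pbow g x :
  comul_iter 1 (pbow g x) =
  \sum_h tbasis [tuple (h, x); ((h^-1 * g)%g, x)].
Proof.
rewrite /= /comul_head (bigD1 [tuple (g, x)]) //= !ffunE theadE eqxx scale1r.
rewrite [X in _ + X]big1 ?addr0 => [|s ns].
  by apply: eq_bigr => h _; congr tbasis; apply: val_inj.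
rewrite !ffunE; case: eqP => [e|_]; last exact: scale0r.
by case/eqP: ns; case/tupleP: s e => y s; rewrite theadE (tuple0 s) => ->;
   apply: val_inj.
Qed.

Definition Lambda : D := (#|gT|%:R : F)^-1 *: \sum_g pbow 1%g g.

(* The product of the m tensor factors of the iterated comultiplication of
   Lambda; only meaningful for m >= 1. *)
Definition Lambda_sweedler m : D := tmul (comul_iter m.-1 Lambda).

Lemma Lambda_sweedler1 : Lambda_sweedler 1 = Lambda.
Proof.
rewrite [RHS]pbow_sum /Lambda_sweedler /tmul /=.
rewrite (reindex (fun t => [tuple t : gT * gT])) /=.
  by apply: eq_bigr => t _; rewrite ffunE theadE big_ord1 (tnth_nth t).
exists (@thead 0 _) => [t|s] _; first exact: theadE.
by case/tupleP: s => y s; rewrite theadE (tuple0 s); apply: val_inj.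
Qed.

Definition FS_indicator m (chi : D -> F) : F := chi (Lambda_sweedler m).

Definition double_module (M : vectType F) (act : D -> 'End(M)) : Prop :=
  [/\ linear act, act 1 = \1%VF
    & forall a b, act (a * b) = (act a \o act b)%VF].

Definition simple_action (M : vectType F) (act : D -> 'End(M)) : Prop :=
  {:M}%VS != 0%VS /\
  forall U : {vspace M}, (forall a, (act a @: U <= U)%VS) ->
    U = 0%VS \/ U = fullv.

Definition action_character (M : vectType F) (act : D -> 'End(M)) (a : D) : F :=
  \tr (passmx.mxof (vbasis fullv) (vbasis fullv) (act a)).

Definition double_irr_character (chi : D -> F) : Prop :=
  exists (M : vectType F) (act : D -> 'End(M)),
    [/\ double_module act, simple_action act & chi =1 action_character act].

End Double.

Section Quotient.
Variables (F : fieldType) (T : vectType F) (W : {vspace T}).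

(* The quotient space T / W, carried by a complement of W; the canonical
   surjection is the projection along W. *)
Definition quotv : vectType F := subvs_of (W^C)%VS.

Definition quotv_pi : 'Hom(T, quotv) :=
  (linfun (vsproj (W^C)%VS) \o daddv_pi (W^C)%VS W)%VF.

Definition quotv_repr : 'Hom(quotv, T) := linfun (@vsval F T (W^C)%VS).

Lemma quotv_capC : (W^C :&: W = 0)%VS.
Proof. by rewrite capvC capv_compl. Qed.

Lemma quotv_reprK v : quotv_pi (quotv_repr v) = v.
Proof.
rewrite /quotv_pi comp_lfunE /quotv_repr !lfunE /=.
by rewrite daddv_pi_id ?quotv_capC ?subvsP ?vsvalK.
Qed.

Lemma lker_quotv_pi : lker quotv_pi = W.
Proof.
apply/vspaceP => v; rewrite memv_ker /quotv_pi comp_lfunE lfunE /=.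
have vE : daddv_pi (W^C)%VS W v + daddv_pi W (W^C)%VS v = v.
  by rewrite daddv_pi_add ?quotv_capC // addvC addv_complf memvf.
apply/eqP/idP => [v0 | vW].
  have : vsval (vsproj (W^C)%VS (daddv_pi (W^C)%VS W v)) = 0 by rewrite v0.
  by rewrite vsprojK ?memv_pi // => e; rewrite -vE e add0r memv_pi.
suff -> : daddv_pi (W^C)%VS W v = 0 by rewrite linear0.
have := daddv_pi_id (capv_compl W) vW => e.
by move: vE; rewrite e -[X in _ = X]add0r => /addIr.
Qed.

End Quotient.

Section Induced.
Variables (F : fieldType) (gT : finGroupType) (u : gT) (d : nat).
Variable V : mx_representation F 'C[u]%g d.
Local Notation D := (drinfeld_double F gT).
Local Open Scope lfun_scope.

(* The left module V is the space 'cV[F]_d, on which c acts by v |-> V c *m v;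
   F[G] (x)_F V is the space of functions gT -> 'cV[F]_d, y (x) v being
   pretens y v, and hatV is its quotient by the balancing relations
   y c (x) v = y (x) c v, that is, F[G] (x)_{F['C[u]]} V. *)
Local Notation pretensor := {ffun gT -> 'cV[F]_d}.

Definition pretens (y : gT) (v : 'cV[F]_d) : pretensor :=
  [ffun z => if z == y then v else 0].

Lemma pretens_linear y : linear (pretens y).
Proof.
move=> k v w; apply/ffunP => z; rewrite !ffunE.
by case: eqP; rewrite ?scaler0 ?addr0.
Qed.

HB.instance Definition _ y :=
  GRing.isLinear.Build F _ pretensor *:%R (pretens y) (pretens_linear y).

Definition balance (y c : gT) (v : 'cV[F]_d) : pretensor :=
  pretens (y * c)%g v - pretens y (V c *m v).

Lemma balance_linear y c : linear (balance y c).
Proof.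
move=> k v w; rewrite /balance linearP mulmxDr -scalemxAr linearP.
by rewrite scalerBr opprD addrACA.
Qed.

HB.instance Definition _ y c :=
  GRing.isLinear.Build F _ pretensor *:%R (balance y c) (balance_linear y c).

Definition balanced_rel : {vspace pretensor} :=
  (\sum_(y : gT) \sum_(c in 'C[u]%g) limg (linfun (balance y c)))%VS.

Local Notation hatV := (quotv balanced_rel).

Definition tens (y : gT) (v : 'cV[F]_d) : hatV :=
  quotv_pi balanced_rel (pretens y v).

Definition preact_basis (h x : gT) (f : pretensor) : pretensor :=
  \sum_(y : gT)
    if (x * y * u * (x * y)^-1 == h)%g then pretens (x * y)%g (f y) else 0.

Lemma preact_basis_linear h x : linear (preact_basis h x).
Proof.
move=> k f f'; rewrite /preact_basis scaler_sumr -big_split.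
apply: eq_bigr => y _ /=; case: ifP => _; last by rewrite scaler0 addr0.
by rewrite !ffunE linearP.
Qed.

HB.instance Definition _ h x := GRing.isLinear.Build F pretensor pretensor
  *:%R (preact_basis h x) (preact_basis_linear h x).

Definition preact (a : D) : 'End(pretensor) :=
  \sum_(s : gT * gT) (a s : F) *: linfun (preact_basis s.1 s.2).

Definition hat_act (a : D) : 'End(hatV) :=
  quotv_pi balanced_rel \o preact a \o quotv_repr balanced_rel.

Lemma tens_balanced y c v :
  c \in 'C[u]%g -> tens (y * c)%g v = tens y (V c *m v).
Proof.
move=> cC; apply/eqP; rewrite /tens -subr_eq0 -linearB -memv_ker lker_quotv_pi.
rewrite -[_ - _]/(balance y c v) -(lfunE (balance y c)).
apply: (subvP (sumv_sup y _ _)) (memv_img _ (memvf v)) => //.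
exact: (sumv_sup c).
Qed.

Lemma pretens_sum (f : pretensor) : f = \sum_y pretens y (f y).
Proof.
apply/ffunP => z; rewrite sum_ffunE (bigD1 z) //= !ffunE eqxx big1 ?addr0 //.
by move=> y nyz; rewrite ffunE eq_sym (negPf nyz).
Qed.

Lemma preact_basis_pretens h x y v :
  preact_basis h x (pretens y v) =
  if (x * y * u * (x * y)^-1 == h)%g then pretens (x * y)%g v else 0.
Proof.
rewrite /preact_basis (bigD1 y) //= !ffunE eqxx big1 ?addr0 // => z nzy.
by rewrite ffunE (negPf nzy) linear0 if_same.
Qed.

Lemma preact_is_linear : linear preact.
Proof.
move=> k a b; rewrite /preact scaler_sumr -big_split; apply: eq_bigr => s _ /=.
by rewrite !ffunE scalerA -scalerDl.
Qed.

HB.instance Definition _ := GRing.isLinear.Build F (drinfeld_double F gT)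
  'End(pretensor) *:%R preact preact_is_linear.

Lemma preact_pbow h x :
  preact (pbow F h x) = linfun (preact_basis h x).
Proof.
rewrite /preact (bigD1 (h, x)) //= !ffunE eqxx scale1r big1 ?addr0 // => s ns.
by rewrite !ffunE (negPf ns) scale0r.
Qed.

Lemma preact_pbow_pretens h x y v :
  preact (pbow F h x) (pretens y v) =
  if (x * y * u * (x * y)^-1 == h)%g then pretens (x * y)%g v else 0.
Proof.
by rewrite preact_pbow (lfunE (preact_basis h x)) /= preact_basis_pretens.
Qed.

Lemma preact_balanced_rel a w :
  w \in balanced_rel -> preact a w \in balanced_rel.
Proof.
move=> wW; suff sub: (preact a @: balanced_rel <= balanced_rel)%VS.
  exact: subvP sub _ (memv_img _ wW).
rewrite limg_sum; apply/subv_sumP => y _.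
rewrite limg_sum; apply/subv_sumP => c cC.
apply/subvP => _ /memv_imgP[_ /memv_imgP[v _ ->] ->].
rewrite lfunE /preact sum_lfunE; apply: memv_suml => [[h x] _] /=.
rewrite scale_lfunE lfunE memvZ //= /balance linearB /= !preact_basis_pretens.
have -> : (x * (y * c) * u * (x * (y * c))^-1 = x * y * u * (x * y)^-1)%g.
  rewrite !mulgA invMg !mulgA -(mulgA (x * y)%g c u) (cent1P cC).
  by rewrite !mulgA mulgK invMg !mulgA.
case: ifP => _; last by rewrite subrr mem0v.
rewrite mulgA -[_ - _]/(balance (x * y) c v) -(lfunE (balance (x * y)%g c)).
apply: (subvP (sumv_sup (x * y)%g _ _)) (memv_img _ (memvf v)) => //.
exact: (sumv_sup c).
Qed.

Lemma hat_act_pi a f :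
  hat_act a (quotv_pi balanced_rel f) = quotv_pi balanced_rel (preact a f).
Proof.
rewrite /hat_act 2!comp_lfunE; apply/eqP.
rewrite -subr_eq0 -!linearB -memv_ker lker_quotv_pi.
apply: preact_balanced_rel.
rewrite -[in X in _ \in X](lker_quotv_pi balanced_rel) memv_ker linearB /=.
by rewrite quotv_reprK subrr.
Qed.

Lemma hat_act_tens h x y v :
  hat_act (pbow F h x) (tens y v) =
  if (x * y * u * (x * y)^-1 == h)%g then tens (x * y)%g v else 0.
Proof.
rewrite /tens hat_act_pi preact_pbow_pretens.
by case: ifP; rewrite ?linear0.
Qed.

Lemma preact1 : preact 1 = \1.
Proof.
apply/lfunP => f; rewrite id_lfunE [in RHS](pretens_sum f) {1}(pretens_sum f).
rewrite linear_sum; apply: eq_bigr => y _ /=.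
rewrite [1]/(done1 F gT) /done1 linear_sum sum_lfunE /=.
rewrite (bigD1 (y * u * y^-1)%g) //= preact_pbow_pretens.
rewrite mul1g eqxx big1 ?addr0 // => g ng.
rewrite preact_pbow_pretens mul1g.
by rewrite eq_sym (negPf ng).
Qed.

Lemma preact_sumE I (r : seq I) (E : I -> drinfeld_double F gT) (k : I -> F) f :
  preact (\sum_(i <- r) k i *: E i) f = \sum_(i <- r) k i *: preact (E i) f.
Proof.
rewrite linear_sum sum_lfunE; apply: eq_bigr => i _ /=.
by rewrite linearZ scale_lfunE.
Qed.

Lemma preactM a b : preact (a * b) = preact a \o preact b.
Proof.
apply/lfunP => f; rewrite comp_lfunE {1}(pbow_sum a) mulr_suml.
under eq_bigr => s _ do rewrite -scalerAl.
rewrite preact_sumE [in RHS](pbow_sum a) preact_sumE.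
apply: eq_bigr => [[k z] _] /=; congr (_ *: _).
rewrite {1}(pbow_sum b) mulr_sumr.
under eq_bigr => s _ do rewrite -scalerAr.
rewrite preact_sumE [in RHS](pbow_sum b) preact_sumE.
rewrite [RHS](linear_sum (preact (pbow F k z))).
apply: eq_bigr => [[h y] _]; rewrite [RHS]linearZ /=; congr (_ *: _).
rewrite pbowM (pretens_sum f) !linear_sum; apply: eq_bigr => x _ /=.
rewrite (preact_pbow_pretens h y).
case: (_ =P h) => [<-|nh].
  rewrite preact_pbow_pretens; case: eqP => [->|nk].
    rewrite preact_pbow_pretens.
    by rewrite !invMg !mulgA eqxx.
  by rewrite linear0 zero_lfunE; case: eqP => // e; case: nk;
     rewrite -e !invMg !mulgA.
rewrite linear0; case: eqP => [->|_]; last by rewrite linear0 zero_lfunE.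
rewrite preact_pbow_pretens; case: eqP => // e.
case: nh; apply: (mulgI z); apply: (mulIg z^-1%g).
by rewrite -e !invMg !mulgA.
Qed.

Lemma hat_double_module : double_module hat_act.
Proof.
have act_eq (A B : 'End(hatV)) :
    (forall f, A (quotv_pi balanced_rel f) = B (quotv_pi balanced_rel f)) ->
    A = B.
  by move=> AB; apply/lfunP => v; rewrite -[v]quotv_reprK AB.
split.
- move=> k a b; apply: act_eq => f.
  rewrite add_lfunE scale_lfunE !hat_act_pi linearP add_lfunE scale_lfunE.
  exact: linearP.
- by apply: act_eq => f; rewrite hat_act_pi preact1 !id_lfunE.
- move=> a b; apply: act_eq => f.
  by rewrite comp_lfunE !hat_act_pi preactM comp_lfunE.
Qed.

End Induced.

Section Characters.
Variables (F : fieldType) (gT : finGroupType).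

(* mx_irreducible V is irreducibility of the right action v |-> v *m V c on row
   vectors; taking annihilators of submodules, it is equivalent to simplicity
   of the left module of column vectors used in hat_act. *)
Definition group_irr_character (H : {group gT}) (eta : gT -> F) : Prop :=
  exists (d : nat) (V : mx_representation F H d),
    mx_irreducible V /\ {in H, forall c, eta c = \tr (V c)}.

Definition induced_character (u : gT) (eta : gT -> F)
    (chi : drinfeld_double F gT -> F) : Prop :=
  exists (d : nat) (V : mx_representation F 'C[u]%G d),
    [/\ mx_irreducible V, {in 'C[u]%G, forall c, eta c = \tr (V c)}
      & chi =1 action_character (hat_act V)].

Definition Gtilde (m : nat) (u : gT) : {set gT} :=
  [set h | ((u * h) ^+ m == h ^+ m)%g].

End Characters.

(* Main.v *)
Require Import Defs.
From mathcomp Require Import all_boot all_order all_fingroup all_algebra.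
From mathcomp Require Import mxrepresentation reals complex.

Import GRing.Theory.
Local Open Scope ring_scope.
Local Open Scope complex_scope.

(** Both assertions are parity arguments. For odd [m], the permutations
    [(u h)^m] and [h^m] have the parities of [u h] and [h], which differ when
    [u] is odd; this is the emptiness of [Gtilde m u].

    For the indicator, the operator by which Lambda^[m] acts on the induced
    module is itself zero. Each comultiplication splits the index [g] of
    [p_g >< x] as [h * (h^-1 * g)], so the basis tensors occurring in the
    [m]-fold coproduct of Lambda, which involves only [p_1 >< x], have indices
    of product 1 ([comul_iter_supp]). A product of basis elements of D(G)
    vanishes unless all their indices are conjugate to the first one, and it is
    then a basis element with that first index ([prod_pbow]). Hence [p_h >< x]
    occurs in Lambda^[m] only if some [m] conjugates of [h] have product 1
    ([Lambda_sweedler_supp]). When [h] is an odd permutation and [m] is odd,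
    a product of [m] conjugates of [h] is odd, so this does not happen. On the
    other side, [p_h >< x] kills the module induced from the centralizer of [u]
    unless [h] is conjugate to [u] ([hat_act_eq0]), and conjugates of an odd
    [u] are odd. *)

Section DoubleSupport.
Variables (F : fieldType) (gT : finGroupType).
Local Notation D := (drinfeld_double F gT).

(** Splitting a tensor factor by the comultiplication leaves the product of the
    indices unchanged, so the [p]-indices of the coproduct of [a] multiply to
    an index occurring in [a]. *)
Lemma comul_iter_supp (Q : pred gT) (a : D) :
    (forall g x, ~~ Q g -> a (g, x) = 0) ->
  forall m (s : m.+1.-tuple (gT * gT)),
    ~~ Q (\prod_(t <- s) t.1)%g -> comul_iter m a s = 0.
Proof.
move=> aQ; elim=> [|m IHm] s.
  case/tupleP: s => [[g x] s]; rewrite (tuple0 s) big_seq1 /= => Qg.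
  by rewrite ffunE theadE aQ.
move=> Qs; rewrite /= /comul_head sum_ffunE big1 // => t _.
rewrite ffunE sum_ffunE.
have [Qt|/IHm ->] := boolP (Q (\prod_(y <- t) y.1)%g); last exact: scale0r.
rewrite big1 ?scaler0 // => h _; rewrite ffunE; case: eqP => // est.
case/negP: Qs; rewrite est /= !big_cons /=.
by case/tupleP: t Qt {est} => y t; rewrite theadE big_cons /= mulgA mulKVg.
Qed.

(** The product of two basis elements is nonzero only if their indices are
    conjugate, and it keeps the index of the left factor. *)
Lemma prod_pbow (s : seq (gT * gT)) (y : gT * gT) :
  \prod_(t <- y :: s) pbow F t.1 t.2 = 0 \/
  (exists x, \prod_(t <- y :: s) pbow F t.1 t.2 = pbow F y.1 x) /\
  all (fun t : gT * gT => t.1 \in y.1 ^: [set: gT])%g (y :: s).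
Proof.
elim: s y => [|z s IHs] y /=.
  rewrite big_seq1 class_refl; right; split=> //; by exists y.2.
rewrite big_cons; case: (IHs z) => [->|[[x ->] zs]].
  by left; rewrite mulr0.
rewrite pbowM; case: eqP => [ey|_]; last by left.
have eyz : (y.1 ^: [set: gT] = z.1 ^: [set: gT])%g.
  have -> : (y.1 = z.1 ^ y.2^-1)%g by rewrite conjgE invgK mulgA.
  by rewrite classGidl ?inE.
right; split; first by exists (y.2 * x)%g.
by rewrite class_refl /= eyz.
Qed.

(** A basis tensor contributing to the coefficient of [p_h >< x] in
    Lambda^[m.+1] has indices conjugate to [h], as its product is nonzero, and
    of product 1, as it comes from Lambda: its indices would be a sequence [s]
    violating the hypothesis. *)
Lemma Lambda_sweedler_supp m (h x : gT) :
    (forall s : seq gT, size s = m.+1 ->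
       all (mem (h ^: [set: gT])%g) s -> (\prod_(y <- s) y)%g != 1%g) ->
  Lambda_sweedler F gT m.+1 (h, x) = 0.
Proof.
move=> noprod; rewrite /Lambda_sweedler /tmul /= sum_ffunE big1 // => s _.
rewrite ffunE.
have [s1|s1] := eqVneq (\prod_(t <- s) t.1)%g 1%g; last first.
  rewrite (@comul_iter_supp (pred1 1%g)) ?scale0r // => g y /= ng.
  rewrite /Lambda ffunE sum_ffunE big1 ?scaler0 // => z _.
  by rewrite ffunE xpair_eqE (negPf ng).
have -> : \prod_(i < m.+1) pbow F (tnth s i).1 (tnth s i).2
    = \prod_(t <- s) pbow F t.1 t.2 by rewrite [RHS]big_tuple.
case/tupleP: s s1 => y s s1 /=.
have [->|[[z ->] ys]] := prod_pbow s y; first by rewrite ffunE scaler0.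
rewrite ffunE; case: (_ =P (y.1, z)) => [[eh _]|_]; last exact: scaler0.
suff /negP[] : (\prod_(g <- [seq t.1 | t <- y :: s]) g)%g != 1%g.
  by rewrite big_map s1.
apply: noprod; first by rewrite size_map /= size_tuple.
by rewrite all_map eh.
Qed.

(** The induced module is graded by [gT], with [tens y v] in degree
    [y * u * y^-1]; the operator of [p_h >< x] is that of [x] followed by the
    projection onto degree [h], so it is zero unless [h] is conjugate to [u]. *)
Lemma hat_act_eq0 (u : gT) d (V : mx_representation F 'C[u]%g d) (a : D) :
    (forall h x, h \in (u ^: [set: gT])%g -> a (h, x) = 0) ->
  hat_act V a = 0.
Proof.
move=> a0; apply/lfunP => v.
rewrite -[v]quotv_reprK hat_act_pi zero_lfunE /preact sum_lfunE.
rewrite big1 ?linear0 // => [[h x] _]; rewrite scale_lfunE lfunE /=.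
have [/a0->|nhu] := boolP (h \in u ^: [set: gT])%g; first exact: scale0r.
rewrite /preact_basis big1 ?scaler0 // => y _; case: eqP => // eh.
case/negP: nhu; apply/imsetP; exists (x * y)^-1%g; rewrite ?inE //.
by rewrite conjgE invgK -eh !mulgA.
Qed.

Lemma action_character_eq0 (M : vectType F) (act : D -> 'End(M)) (a : D) :
  act a = 0 -> action_character act a = 0.
Proof.
rewrite /action_character => /eqP.
rewrite -(passmx.mxof_eq0 (vbasisP _) (vbasisP _)) => /eqP ->.
exact: mxtrace0.
Qed.

End DoubleSupport.

Lemma odd_perm_class {T : finType} (u v : {perm T}) :
  v \in (u ^: [set: {perm T}])%g -> odd_perm v = odd_perm u.
Proof. by case/imsetP=> w _ ->; rewrite odd_permJ. Qed.

Lemma odd_perm_prod_odd {T : finType} (s : seq {perm T}) :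
  all (@odd_perm T) s -> odd_perm (\prod_(v <- s) v)%g = odd (size s).
Proof.
elim: s => [|v s IHs] /=; first by rewrite big_nil odd_perm1.
by case/andP=> v1 /IHs IH; rewrite big_cons odd_permM v1 IH.
Qed.

Lemma odd_permX {T : finType} (v : {perm T}) m :
  odd_perm (v ^+ m)%g = odd m && odd_perm v.
Proof.
elim: m => [|m IHm]; first by rewrite expg0 odd_perm1.
by rewrite expgS odd_permM IHm /=; case: (odd m); case: (odd_perm v).
Qed.

Theorem proposition3p4p1 (R : realType) (n : nat) (u : 'S_n) (m : nat)
    (hu : odd_perm u) (hm : odd m) :
  Gtilde m u = set0 /\
  forall (eta : 'S_n -> R[i]) (chi : drinfeld_double R[i] 'S_n -> R[i]),
    group_irr_character 'C[u]%G eta ->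
    double_irr_character chi ->
    induced_character u eta chi ->
    FS_indicator m chi = 0.
Proof.
split.
  apply/setP => h; rewrite !inE; apply/eqP => /(congr1 (@odd_perm _)).
  by rewrite !odd_permX hm odd_permM hu; case: (odd_perm h).
move=> eta chi _ _ [d [V [_ _ chiE]]]; rewrite /FS_indicator chiE.
apply/action_character_eq0/hat_act_eq0 => h x hcu.
case: m hm => // m hm; apply: Lambda_sweedler_supp => s sz hs.
apply/eqP => /(congr1 (@odd_perm _)).
rewrite odd_perm1 odd_perm_prod_odd ?sz ?hm //.
by apply: sub_all hs => v /odd_perm_class ->; rewrite (odd_perm_class _ _ hcu).
Qed.
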